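(* Assume that $\lim_{n\to\infty}p_n^-=\infty$, that $p_n^+\le\mu p_n^-$ for all $n$ for some constant $\mu>1$, and that $\Phi_n(x,1)=1$ for a.e. $x\in\Omega$ and all $n\ge1$. Let $g\in Lip(\partial\Omega)$, $\eta=\|g\|_{Lip(\partial\Omega)}<\infty$, and let $u_n$ be the unique minimizer of $$E_n(u)=\int_\Omega\frac{\Phi_n(x,|\nabla u|)}{\varphi_n(x,1)}\,dx$$ in $g+W_0^{1,\Phi_n(\cdot)}(\Omega)$. Then for all $m\ge1$ and all $n\ge1$ for which $p_n^-\ge m$, $$\|\nabla u_n\|_{L^m}\le12\mu(1+\eta^\mu)(1+|\Omega|)^2.$$
   Context: $\Omega\subset\mathbb{R}^d$ is a bounded smooth domain with Lebesgue measure $|\Omega|$. For each $n\ge1$, $\varphi_n\in C(\overline\Omega\times[0,\infty))\cap C^1(\Omega\times(0,\infty))$, $\varphi_n(x,s)>0$ for $x\in\Omega$, $s>0$, and there are constants $p_n^-,p_n^+>0$ with $0<p_n^--1\le \frac{s\,\partial_s\varphi_n(x,s)}{\varphi_n(x,s)}\le p_n^+-1$ for all $x\in\Omega$, $s>0$. Put $\Phi_n(x,s)=\int_0^s\varphi_n(x,t)\,dt$. For $\Phi=\Phi_n$ let $\varrho_{\Phi(\cdot)}(u)=\int_\Omega\Phi(x,|u|)\,dx$; $L^{\Phi(\cdot)}(\Omega)=\{u\in L^1(\Omega):\lim_{\lambda\to0}\varrho_{\Phi(\cdot)}(\lambda u)=0\}$ with norm $\inf\{\lambda>0:\varrho_{\Phi(\cdot)}(u/\lambda)\le1\}$;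 $W^{1,\Phi(\cdot)}(\Omega)$ is the set of $u\in L^{\Phi(\cdot)}(\Omega)$ with weak partial derivatives in $L^{\Phi(\cdot)}(\Omega)$, normed by $\inf\{\lambda>0:\varrho_{\Phi(\cdot)}(u/\lambda)+\sum_k\varrho_{\Phi(\cdot)}(\partial_ku/\lambda)\le1\}$, and $W^{1,\Phi(\cdot)}_0(\Omega)$ is the closure of $C_0^\infty(\Omega)$ in it. $\|g\|_{Lip(\partial\Omega)}=\sup_{x\ne y\in\partial\Omega}|g(x)-g(y)|/|x-y|$; $g$ also denotes its absolutely minimal Lipschitz extension into $\Omega$, for which $\|\nabla g\|_{L^\infty(\Omega)}\le\|g\|_{Lip(\partial\Omega)}$. *)

(* Defs.v *)
From HB Require Import structures.
From mathcomp Require Import all_boot all_order all_algebra.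
From mathcomp Require Import all_classical all_reals all_analysis.
From mathcomp Require Import lra.

Set Implicit Arguments.
Unset Strict Implicit.
Unset Printing Implicit Defensive.
Import Order.TTheory GRing.Theory Num.Theory.
Import numFieldNormedType.Exports.

Local Open Scope classical_set_scope.
Local Open Scope ring_scope.

(* 'rV[R]_d carries the Borel sigma-algebra of its (norm) topology, in line with
   the library's measurableTypeR and lebesgue_measure on R. *)
Section BorelRV.
Context (R : realType) (d : nat).
Let borel : set (set 'rV[R]_d) := <<s open >>.
Let borel0 : borel set0. Proof. exact: sigma_algebra0. Qed.
Let borelC A : borel A -> borel (~` A). Proof. exact: sigma_algebraC. Qed.
Let borelU (F : _^nat) : (forall i, borel (F i)) -> borel (\bigcup_i F i).
Proof. exact: sigma_algebra_bigcup. Qed.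
HB.instance Definition _ := @isMeasurable.Build
  (sigma_display (@open 'rV[R]_d)) 'rV[R]_d borel borel0 borelC borelU.
End BorelRV.

Lemma open_measurable_rV (R : realType) (d : nat) (A : set 'rV[R]_d) :
  open A -> measurable A.
Proof. by move=> oA; exact: sub_sigma_algebra. Qed.

Section LebesgueRV.
Context (R : realType).
Local Notation TR := (measurableTypeR R).

(* 'rV_n.+1 is convertible to 'rV_(1 + n). *)
Definition rV_cons n (z : TR * 'rV[R]_n) : 'rV[R]_n.+1 :=
  row_mx (z.1%:M : 'rV[R]_1) z.2.

Definition rV_uncons n (v : 'rV[R]_n.+1) : R * 'rV[R]_n :=
  (lsubmx (v : 'rV[R]_(1 + n)) ord0 ord0, rsubmx (v : 'rV[R]_(1 + n))).

Lemma rV_consK n : cancel (@rV_cons n) (@rV_uncons n).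
Proof.
case=> t v.
by rewrite /rV_uncons /rV_cons /= row_mxKl row_mxKr mxE eqxx mulr1n.
Qed.

Lemma measurable_rV_uncons n : measurable_fun setT (@rV_uncons n : _ -> TR * _).
Proof.
have cont (T : pseudoMetricType R) (f : 'rV[R]_n.+1 -> T) :
    (forall v w e, ball v e w -> ball (f v) e (f w)) ->
    forall V, open V -> measurable (f @^-1` V).
  move=> fball V oV; apply: open_measurable_rV; rewrite openE => v /= Vv.
  have /nbhs_ballP [e /= e0 eV] := open_nbhs_nbhs (conj oV Vv).
  by apply/nbhs_ballP; exists e => //= w vw; exact/eV/fball.
apply/measurable_fun_pairP; split.
  apply: (measurability _ (measurable_realfun.RGenOpens.measurableE R)).
  move=> _ [_ [a [b ->]] <-]; rewrite setTI.
  apply: (cont R); last exact: interval_open.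
  move=> v w e [_ vw] /=.
  by rewrite !mxE; exact: vw.
apply: (measurability (@open 'rV[R]_n)) => [//|_ [V oV <-]]; rewrite setTI.
apply: (cont 'rV[R]_n) => // v w e [e0 vw]; split=> // i j.
by rewrite !mxE; exact: vw.
Qed.

Lemma rV_cons_ball n (a t : R) (w v : 'rV[R]_n) (e : R) : 0 < e ->
  ball a e t -> ball w e v -> ball (rV_cons (a, w)) e (rV_cons (t, v)).
Proof.
move=> e0 ae [_ we]; split=> // i j; rewrite /rV_cons /=.
case: (@split_ordP 1 n j) => k ->.
  by rewrite !(@row_mxEl R 1 1 n) !mxE !ord1 /= !mulr1n.
by rewrite !(@row_mxEr R 1 1 n); exact: we.
Qed.

Lemma measurable_rV_cons n : measurable_fun setT (@rV_cons n).
Proof.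
apply: (measurability (@open 'rV[R]_n.+1)) => [//|_ [V oV <-]]; rewrite setTI.
pose B (q : rat * 'rV[rat]_n * rat) : set (TR * 'rV[R]_n) :=
  ball (ratr q.1.1 : R) (ratr q.2 : R) `*`
  ball (map_mx ratr q.1.2 : 'rV[R]_n) (ratr q.2 : R).
suff -> : @rV_cons n @^-1` V =
    \bigcup_(q in [set q | B q `<=` @rV_cons n @^-1` V]) B q.
  rewrite bigcup_mkcond; apply: countable_bigcupT_measurable => // q.
  have [_|_] := boolP (q \in _); last exact: measurable0.
  have [q0|q0] := ltP 0 (ratr q.2 : R).
    apply: measurableX.
      by apply: measurable_realfun.open_measurable; exact: ball_open.
    by apply: open_measurable_rV; exact: ball_open.
  suff -> : B q = set0 by exact: measurable0.
  by apply/seteqP; split=> // -[x y] [_ []]; rewrite ltNge q0.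
apply/seteqP; split=> [[t v] /= Vtv|z [q qV Bz]]; last exact: qV.
have /nbhs_ballP [e /= e0 eV] := open_nbhs_nbhs (conj oV Vtv).
have [r] := @rat_in_itvoo R 0 (e / 2) (divr_gt0 e0 (ltr0Sn R 1)).
rewrite in_itv/= => /andP[r0 re].
have approx (x : R) : {q : rat | `|ratr q - x| < ratr r}.
  have /rat_in_itvoo/cid[q] : x - ratr r < x + ratr r by lra.
  by rewrite in_itv/= => qx; exists q; rewrite ltr_distl.
pose w : 'rV[rat]_n := \row_i projT1 (approx (v ord0 i)).
exists (projT1 (approx t), w, r).
  move=> [t' v'] [/= t't v'v]; apply: eV.
  have at_ : ball t (ratr r) (ratr (projT1 (approx t))).
    by rewrite /ball/= distrC; exact: projT2 (approx t).
  have aw : ball v (ratr r) (map_mx ratr w : 'rV[R]_n).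
    split=> // i j; rewrite !mxE !ord1 /ball/= distrC.
    exact: projT2 (approx (v ord0 j)).
  apply: le_ball (_ : ratr r + ratr r <= e) _ _; first lra.
  by apply: rV_cons_ball;
    [lra|exact: ball_triangle at_ t't|exact: ball_triangle aw v'v].
split=> /=; first exact: projT2 (approx t).
split=> // i j; rewrite !mxE !ord1 /ball/=.
exact: projT2 (approx (v ord0 j)).
Qed.

Section step.
Context n (m : {sigma_finite_measure set 'rV[R]_n -> \bar R}).

Definition lebesgue_rV_step : set 'rV[R]_n.+1 -> \bar R :=
  pushforward (@lebesgue_measure R \x m)%E (@rV_cons n).

HB.instance Definition _ := Measure.copy lebesgue_rV_step
  (measure_function_pushforward__canonical__measure_function_Measure
    (@lebesgue_measure R \x m)%E (measurable_rV_cons (n := n))).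

Let step_sigma_finite : sigma_finite setT lebesgue_rV_step.
Proof.
have lebT := @sigma_finiteT _ _ _ (@lebesgue_measure R).
have /sigma_finiteP [F [FT ndF Foo]] := lebT.
have /sigma_finiteP [G [GT ndG Goo]] := sigma_finiteT m.
exists (fun k => @rV_uncons n @^-1` (F k `*` G k)).
  rewrite -preimage_bigcup; apply/seteqP; split=> // v _ /=.
  have [i _ Fi] : (\bigcup_i F i) (rV_uncons v).1 by rewrite -FT.
  have [j _ Gj] : (\bigcup_i G i) (rV_uncons v).2 by rewrite -GT.
  exists (maxn i j) => //; split.
  - exact: (subsetPset _ _ (ndF _ _ (leq_maxl i j))) Fi.
  - exact: (subsetPset _ _ (ndG _ _ (leq_maxr i j))) Gj.
move=> k; have [mF Fk] := Foo k; have [mG Gk] := Goo k.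
split.
  rewrite -[X in measurable X]setTI; apply: measurable_rV_uncons => //.
  exact: measurableX.
rewrite /lebesgue_rV_step /pushforward -comp_preimage.
rewrite (_ : _ @^-1` _ = F k `*` G k); last first.
  by apply/seteqP; split=> -[t v];
    rewrite /preimage /rV_cons /= row_mxKl row_mxKr mxE eqxx mulr1n.
rewrite [ltLHS](_ : _ = @lebesgue_measure R (F k) * m (G k))%E.
  by rewrite lte_mul_pinfty// ge0_fin_numE.
exact: product_measure1E.
Qed.

HB.instance Definition _ := Measure_isSigmaFinite.Build _ _ _
  lebesgue_rV_step step_sigma_finite.
End step.

(* Lebesgue measure on R^n as an iterated product; see lebesgue_rV_box. *)
Fixpoint lebesgue_rV n : {sigma_finite_measure set 'rV[R]_n -> \bar R} :=
  match n with
  | 0%N => \d_(0 : 'rV[R]_0)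
  | n'.+1 => lebesgue_rV_step (lebesgue_rV n')
      : {sigma_finite_measure set _ -> \bar R}
  end.

Lemma measurable_rV_box n (A : 'I_n -> set TR) : (forall i, measurable (A i)) ->
  measurable [set v : 'rV[R]_n | forall i, A i (v ord0 i)].
Proof.
move=> mA; have coord i : measurable_fun setT (fun v : 'rV[R]_n => v ord0 i : TR).
  apply: (measurability _ (measurable_realfun.RGenOpens.measurableE R)).
  move=> _ [_ [a [b ->]] <-]; rewrite setTI; apply: open_measurable_rV.
  by apply: open_comp => [v _|]; [exact: coord_continuous|exact: interval_open].
rewrite (_ : [set _ | _] = \bigcap_i ((fun v : 'rV[R]_n => v ord0 i) @^-1` A i)).
  apply: fin_bigcap_measurable => // i _; rewrite -[X in measurable X]setTI.
  exact: coord.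
by apply/seteqP; split=> v /= vA i; [move=> _|]; exact: vA.
Qed.

Lemma lebesgue_rV_box n (A : 'I_n -> set TR) : (forall i, measurable (A i)) ->
  lebesgue_rV n [set v | forall i, A i (v ord0 i)] =
  (\prod_(i < n) @lebesgue_measure R (A i))%E.
Proof.
elim: n A => [|n IH] A mA.
  by rewrite big_ord0 /= diracE mem_set//= => -[].
have mA' i : measurable (A (lift ord0 i)) by exact: mA.
rewrite big_ord_recl -(IH _ mA').
rewrite -(product_measure1E (@lebesgue_measure R) (lebesgue_rV n))//; last first.
  exact: (measurable_rV_box mA').
rewrite /= /lebesgue_rV_step /pushforward; congr (product_measure1 _ _ _).
have row0 (t : R) (v : 'rV[R]_n) : rV_cons (t, v) ord0 ord0 = t.
  rewrite (_ : ord0 = @lshift 1 n ord0); last exact: val_inj.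
  by rewrite /rV_cons (@row_mxEl R 1 1 n) mxE.
have rowS (t : R) (v : 'rV[R]_n) i :
    rV_cons (t, v) ord0 (lift ord0 i) = v ord0 i.
  rewrite (_ : lift ord0 i = @rshift 1 n i); last exact: val_inj.
  by rewrite /rV_cons (@row_mxEr R 1 1 n).
apply/seteqP; split=> -[t v] /=.
  move=> tvA; split=> [|i]; first by have := tvA ord0; rewrite row0.
  by have := tvA (lift ord0 i); rewrite rowS.
by move=> [At Av] i; case: (unliftP ord0 i) => [j ->|->]; rewrite ?row0 ?rowS.
Qed.

End LebesgueRV.

Section Sobolev.
Context (R : realType).

Section Smoothness.
Context (V : normedModType R).

Definition iter_derive (f : V -> R) (vs : seq V) : V -> R :=
  foldr (fun v h => 'D_v h) f vs.

(* In finite dimension, existence and continuity of all (iterated) directional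
   derivatives is the same as that of all (iterated) partial derivatives. *)
Definition C1_on (U : set V) (f : V -> R) : Prop :=
  forall v x, U x -> derivable f x v /\ {for x, continuous ('D_v f)}.

Definition smooth_on (U : set V) (f : V -> R) : Prop :=
  forall vs x, U x -> {for x, continuous (iter_derive f vs)} /\
    forall v, derivable (iter_derive f vs) x v.

Definition boundary (A : set V) : set V := closure A `\` A°.

(* Smoothness of the boundary is expressed by local defining functions. *)
Definition smooth_domain (Omega : set V) : Prop :=
  [/\ open Omega, connected Omega, Omega !=set0 &
    forall x0, boundary Omega x0 -> exists (U : set V) (rho : V -> R),
      [/\ open U, U x0, smooth_on U rho, (exists v, 'D_v rho x0 != 0) &
          Omega `&` U = [set x | rho x < 0] `&` U] ].

Definition test_function (Omega : set V) (psi : V -> R) : Prop :=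
  [/\ smooth_on setT psi, compact (closure [set x | psi x != 0]) &
      closure [set x | psi x != 0] `<=` Omega].

End Smoothness.

Context (d : nat).
Implicit Types (Omega : set 'rV[R]_d) (u g G : 'rV[R]_d -> R)
  (w : 'rV[R]_d -> 'rV[R]_d) (phi Phi : 'rV[R]_d -> R -> R).
Local Notation lambda := (lebesgue_rV R d).

(* The norm provided by the library on 'rV[R]_d is the sup norm. *)
Definition enorm (v : 'rV[R]_d) : R := Num.sqrt (\sum_i v ord0 i ^+ 2).

Definition unit_vec (k : 'I_d) : 'rV[R]_d := delta_mx ord0 k.

Definition grad u : 'rV[R]_d -> 'rV[R]_d :=
  fun x => \row_k 'D_(unit_vec k) u x.

Definition lip_const (A : set 'rV[R]_d) (f : 'rV[R]_d -> R) : \bar R :=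
  ereal_sup [set r | exists x y, [/\ A x, A y, x != y &
    r = (`|f x - f y| / enorm (x - y))%:E] ].

(* In particular (take V := Omega) G has the same Lipschitz constant on Omega
   as g on its boundary. *)
Definition is_amle Omega g G : Prop :=
  [/\ {within closure Omega, continuous G},
      forall x, boundary Omega x -> G x = g x &
      forall V, open V -> V `<=` Omega ->
        lip_const V G = lip_const (boundary V) G].

Definition Lnorm_on Omega (p : \bar R) (f : 'rV[R]_d -> R) : \bar R :=
  'N[lambda]_p [EFin \o (f \_ Omega)].

Definition loc_integrable Omega u : Prop :=
  measurable_fun Omega u /\
  forall K, compact K -> K `<=` Omega -> lambda.-integrable K (EFin \o u).

Definition is_weak_partial Omega (k : 'I_d) u (v : 'rV[R]_d -> R) : Prop :=
  [/\ loc_integrable Omega u, loc_integrable Omega v &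
      forall psi, test_function Omega psi ->
        \int[lambda]_(x in Omega) (u x * 'D_(unit_vec k) psi x) =
        - \int[lambda]_(x in Omega) (v x * psi x)].

(* Functions are not quotiented by a.e. equality, so a weak gradient is only
   determined almost everywhere and is handled as a relation. *)
Definition is_weak_grad Omega u w : Prop :=
  forall k, is_weak_partial Omega k u (fun x => w x ord0 k).

Definition integrand phi (pm pp : R) Omega : Prop :=
  [/\ {within closure Omega `*` [set s : R | 0 <= s],
        continuous (fun z : 'rV[R]_d * R => phi z.1 z.2)},
      C1_on (Omega `*` [set s : R | 0 < s])
        (fun z : 'rV[R]_d * R => phi z.1 z.2),
      forall x s, Omega x -> 0 < s -> 0 < phi x s,
      [/\ 0 < pm, 0 < pp & 0 < pm - 1] &
      forall x s, Omega x -> 0 < s ->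
        pm - 1 <= s * derive1 (phi x) s / phi x s <= pp - 1].

Definition primitive phi : 'rV[R]_d -> R -> R :=
  fun x s => \int[@lebesgue_measure R]_(t in `[0, s]) phi x t.

Definition modular Omega Phi u : \bar R :=
  (\int[lambda]_(x in Omega) (Phi x `|u x|)%:E)%E.

Definition LPhi Omega Phi u : Prop :=
  lambda.-integrable Omega (EFin \o u) /\
  modular Omega Phi (fun x => l * u x) @[l --> (0 : R)^'] --> 0%E.

Definition W1Phi Omega Phi u w : Prop :=
  [/\ LPhi Omega Phi u, is_weak_grad Omega u w &
      forall k, LPhi Omega Phi (fun x => w x ord0 k)].

Definition W1Phi_norm Omega Phi u w : \bar R :=
  ereal_inf [set l%:E | l in [set l : R | 0 < l /\
    (modular Omega Phi (fun x => (u x / l)%R) +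
     \sum_(k < d) modular Omega Phi (fun x => (w x ord0 k / l)%R) <= 1)%E]].

Definition W1Phi0 Omega Phi u : Prop :=
  exists2 w, W1Phi Omega Phi u w &
    forall e : R, 0 < e -> exists2 psi, test_function Omega psi &
      (W1Phi_norm Omega Phi (u \- psi)%R (fun x => (w x - grad psi x)%R)
        < e%:E)%E.

Definition energy Omega phi w : \bar R :=
  (\int[lambda]_(x in Omega)
    (primitive phi x (enorm (w x)) / phi x 1)%:E)%E.

Definition is_minimizer Omega phi G u : Prop :=
  W1Phi0 Omega (primitive phi) (u \- G) /\
  forall du v dv, is_weak_grad Omega u du ->
    W1Phi0 Omega (primitive phi) (v \- G) -> is_weak_grad Omega v dv ->
    (energy Omega phi du <= energy Omega phi dv)%E.

Definition is_unique_minimizer Omega phi G u : Prop :=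
  is_minimizer Omega phi G u /\
  forall v, is_minimizer Omega phi G v ->
    {ae lambda, forall x, Omega x -> v x = u x}.

End Sobolev.

(* Main.v *)
Require Import Defs.
From mathcomp Require Import all_boot all_order all_algebra.
From mathcomp Require Import all_classical all_reals all_analysis.
From mathcomp Require Import measurable_realfun ess_sup_inf lra ring.
Import Order.TTheory GRing.Theory Num.Theory.
Import numFieldNormedType.Exports.
Local Open Scope classical_set_scope.
Local Open Scope ring_scope.

Set Implicit Arguments.
Unset Strict Implicit.
Unset Printing Implicit Defensive.

(** Write P(x, s) for the primitive of phi(x, .) and lambda for the Lebesgue
    measure.  A minimizer has energy at most that of the competitor G, whose
    gradient is bounded by eta almost everywhere; everything else is a
    comparison of P(x, s) with powers of s.

    The growth condition pm - 1 <= s phi' / phi <= pp - 1 integrates to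
    pm P(s) <= s phi(s) <= pp P(s) ([mul_primitive_le], [le_mul_primitive]).
    At s = 1, where P = 1, this gives pm <= phi(x, 1) <= pp; as a bound on the
    logarithmic derivative of P it gives s ^ pm <= P(s) <= s ^ pp for s >= 1
    ([powR_le_primitive], [primitive_le_powR]).

    Let M = max(1, eta) and K = M ^ mu.  As pp <= mu pm, M ^ pp <= K ^ pm, so
    the energy of G is at most K ^ pm lambda(Omega) / pm ([energy_le]).
    Conversely, if |w| > K then, because m <= pm,
      |w| ^ m <= K ^ (m - pm) |w| ^ pm <= K ^ (m - pm) P(|w|)
              <= pp K ^ (m - pm) P(|w|) / phi(x, 1),
    and |w| ^ m <= K ^ m otherwise.  Integrating ([integral_powR_le_energy]) and
    inserting the energy bound, the factors K ^ (m - pm) and K ^ pm recombine: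
      \int |grad u| ^ m <= K ^ m (1 + pp / pm) lambda(Omega)
                        <= K ^ m (1 + mu) lambda(Omega).
    The m-th root of this is at most K (1 + (1 + mu) lambda(Omega)), and
    K <= 1 + eta ^ mu.  Comparing |w| with K rather than with 1 is what makes
    K ^ m, and not K ^ pm, the common factor of both terms.

    The energy density x |-> P(x, |w x|) / phi(x, 1) is compared with measurable
    functions without discussing its own measurability: the integral of a
    nonnegative function is a supremum over simple functions below it, hence
    monotone for arbitrary functions, even up to null sets
    ([nonmeas_ae_ge0_le_integral]). *)

(** * Comparison of a primitive with powers *)

Section Growth.
Context {R : realType}.
Implicit Types (F f : R -> R) (p s : R).

(** The difference t f(t) - p F(t) vanishes at 0 and has derivative
    t f'(t) - (p - 1) f(t) >= 0.  No sign is imposed on f, so that the reverse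
    comparison follows by passing to - f and - F. *)
Lemma primitive_mul_le F f p s : F 0 = 0 -> 0 <= s ->
  {within `[0, s], continuous F} -> {within `[0, s], continuous f} ->
  (forall t : R, 0 < t -> is_derive t 1 F (f t)) ->
  (forall t : R, 0 < t -> derivable f t 1) ->
  (forall t : R, 0 < t -> (p - 1) * f t <= t * derive1 f t) ->
  p * F s <= s * f s.
Proof.
move=> F0 s0 cF cf dF df fp.
pose H t := t * f t - p * F t.
have dH (t : R) : 0 < t -> is_derive t 1 H (t * derive1 f t - (p - 1) * f t).
  move=> t0; have ft := dF t t0.
  have : is_derive t 1 f (derive1 f t).
    by rewrite derive1E; apply: DeriveDef => //; exact: df.
  move=> ?; rewrite /H.
  apply: is_derive_eq.
  by rewrite /GRing.scale /=; ring.
have cH : {within `[0, s], continuous H}.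
  have cid : {within `[0, s], continuous (idfun : R -> R)}.
    by apply: continuous_subspaceT => x; exact: cvg_id.
  move=> t; apply: cvgB; apply: cvgM => //.
  - exact: cid.
  - exact: cf.
  - exact: cvg_cst.
  - exact: cF.
suff : H 0 <= H s by rewrite /H F0 mulr0 mul0r subrr subr_ge0.
apply: (ger0_derive1_le_cc _ _ cH) => //.
- by move=> t; rewrite in_itv/= => /andP[t0 _]; have [] := dH t t0.
- move=> t; rewrite in_itv/= => /andP[t0 _].
  by rewrite derive1E; have [_ ->] := dH t t0; rewrite subr_ge0 fp.
- by rewrite in_itv/= lexx s0.
- by rewrite in_itv/= lexx s0.
Qed.

(** The hypothesis says that F(t) t ^ (- p) has a nonnegative derivative; as
    above, upper bounds come from applying this to - F. *)
Lemma power_lower_growth F f p s : 1 <= s ->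
  (forall t : R, 0 < t -> is_derive t 1 F (f t)) ->
  (forall t : R, 0 < t -> p * F t <= t * f t) ->
  F 1 * s `^ p <= F s.
Proof.
move=> s1 dF Fp.
pose H t := F t * t `^ (- p).
have dH (t : R) : 0 < t ->
    is_derive t 1 H (t `^ (- p - 1) * (t * f t - p * F t)).
  move=> t0; have Ft := dF t t0.
  have t0' : t \in `]0, +oo[%R by rewrite in_itv/= t0.
  have : is_derive t 1 (fun x : R => x `^ (- p)) (- p * t `^ (- p - 1)).
    have /= <- := @powR_derive1 R (- p) t t0'.
    by rewrite derive1E; apply: DeriveDef => //; exact: derivable_powR.
  move=> ?; rewrite /H; apply: is_derive_eq.
  (* so that both terms of the product rule carry the factor t ^ (- p - 1) *)
  have -> : t `^ (- p) = t * t `^ (- p - 1).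
    have t_neq0 : t != 0 by rewrite gt_eqF.
    by rewrite powRB ?t_neq0 ?implybT// powRr1 ?(ltW t0)// mulrC divfK.
  by rewrite /GRing.scale /=; ring.
have H1s : H 1 <= H s.
  have dH' (t : R) : t \in `]1, s[%R ->
    is_derive t 1 H (t `^ (- p - 1) * (t * f t - p * F t)).
    by rewrite in_itv/= => /andP[t1 _]; exact/dH/(lt_trans ltr01).
  apply: (@ger0_derive1_le_cc R H 1 s) => //.
  - by move=> t /dH'[].
  - move=> t ts; rewrite derive1E; have [_ ->] := dH' t ts.
    rewrite mulr_ge0 ?powR_ge0// subr_ge0 Fp//.
    by move: ts; rewrite in_itv/= => /andP[t1 _]; exact/(lt_trans ltr01).
  - apply: derivable_within_continuous => t; rewrite in_itv/= => /andP[t1 _].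
    by have [] := dH t (lt_le_trans ltr01 t1).
  - by rewrite in_itv/= lexx s1.
  - by rewrite in_itv/= lexx s1.
have sp0 : 0 < s `^ p by rewrite powR_gt0// (lt_le_trans ltr01).
by rewrite -ler_pdivlMr// -powRN; move: H1s; rewrite /H powR1 mulr1.
Qed.

End Growth.

(** * Monotonicity of the integral without measurability *)

Section Integral.
Local Open Scope ereal_scope.
Context {d} {T : measurableType d} {R : realType}.
Variable mu : {measure set T -> \bar R}.
Implicit Types (D : set T) (f g : T -> \bar R).
Import HBNNSimple.

Lemma nonmeas_ge0_le_integral D f g : (forall x, D x -> 0 <= f x) ->
  (forall x, D x -> f x <= g x) ->
  \int[mu]_(x in D) f x <= \int[mu]_(x in D) g x.
Proof.
move=> f0 fg; have g0 x : D x -> 0 <= g x.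
  by move=> Dx; exact: le_trans (f0 x Dx) (fg x Dx).
rewrite !ge0_integralE//; apply: le_ereal_sup => _ [h /= hf <-].
exists h => //= x; apply: le_trans (hf x) _.
by rewrite /patch; case: ifPn => // /set_mem; exact: fg.
Qed.

(** A simple function below f has the same integral as its restriction to the
    complement of the exceptional null set, where it lies below g. *)
Lemma nonmeas_ae_ge0_le_integral D f g : (forall x, D x -> 0 <= f x) ->
  (forall x, D x -> 0 <= g x) ->
  {ae mu, forall x, D x -> f x <= g x} ->
  \int[mu]_(x in D) f x <= \int[mu]_(x in D) g x.
Proof.
move=> f0 g0 [N [mN N0 fgN]].
rewrite (ge0_integralE _ f0); apply: ge_ereal_sup => _ [h /= hf <-].
rewrite -integralT_nnsfun (ge0_negligible_integral mN measurableT _ _ N0)//;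
  last 2 first.
- by apply/measurable_EFinP.
- by move=> x _; rewrite lee_fin.
rewrite integral_mkcond [leRHS]integral_mkcond; apply: nonmeas_ge0_le_integral.
  by move=> x _; rewrite erestrict_ge0// => y _; rewrite lee_fin.
move=> x _; rewrite {1}/patch; case: ifPn => [/set_mem[_ Nx]|_]; last first.
  exact: erestrict_ge0.
apply: le_trans (hf x) _; rewrite /patch; case: ifPn => // /set_mem Dx.
by apply: contrapT => nfg; apply: Nx; apply: fgN => /(_ Dx).
Qed.

End Integral.

(** * Growth of the primitive of an integrand *)

Section Integrand.
Context {R : realType} {d : nat} (Omega : set 'rV[R]_d).
Context (phi : 'rV[R]_d -> R -> R) (pm pp : R).
Context (hphi : integrand phi pm pp Omega).

Lemma primitive0 (x : 'rV[R]_d) : primitive phi x 0 = 0.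
Proof. by rewrite /primitive set_itv1 Rintegral_set1. Qed.

Context (x : 'rV[R]_d) (Ox : Omega x).

(** The closed interval matters: continuity at 0 is what lets the growth
    inequality start from primitive phi x 0 = 0. *)
Lemma integrand_continuous (s : R) : {within `[0, s], continuous (phi x)}.
Proof.
have [/subspace_continuousP cphi _ _ _ _] := hphi.
apply/subspace_continuousP => t; rewrite /= in_itv/= => /andP[t0 _].
have Axt : (closure Omega `*` [set s : R | 0 <= s]) (x, t).
  by split => //=; exact: subset_closure.
suff xt : (fun u : R => (x, u)) @ within `[0, s] (nbhs t) -->
    within (closure Omega `*` [set s : R | 0 <= s]) (nbhs (x, t)).
  exact: cvg_comp xt (cphi _ Axt).
move=> B /= xtB; rewrite !nbhs_simpl/=.
have tB : \forall u \near t,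
    (closure Omega `*` [set s : R | 0 <= s]) (x, u) -> B (x, u).
  have xt : (fun u : R => (x, u)) @ t --> (x, t).
    exact: (cvg_pair (cvg_cst x) (@cvg_id _ (nbhs t))).
  exact: xt _ xtB.
apply: filterS tB => u xuB; rewrite /= in_itv/= => /andP[u0 _].
by apply: xuB; split => //=; exact: subset_closure.
Qed.

Lemma integrand_derivable (s : R) : 0 < s -> derivable (phi x) s 1.
Proof.
(* the direction (0, 1) of the product space isolates the second variable *)
have [_ + _ _ _] := hphi => /(_ (0, 1) (x, s)) C1 s0.
have [/cvg_ex[l /= C1l] _] := C1 (conj Ox s0).
apply/cvg_ex; exists l; apply: cvg_trans C1l; apply: near_eq_cvg.
near=> h; rewrite /= scaler0 add0r.
by [].
Unshelve. all: by end_near. Qed.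

Lemma integrand_is_derive_primitive (s : R) : 0 < s ->
  is_derive s 1 (primitive phi x) (phi x s).
Proof.
move=> s0.
have s1 : s < s + 1 by rewrite ltrDl.
have [||||dP <-] := @continuous_FTC1 R (phi x) (BLeft 0) s (s + 1).
- exact: s1.
- apply: continuous_compact_integrable; first exact: segment_compact.
  exact: integrand_continuous.
- by rewrite /= lte_fin.
- by apply/differentiable_continuous/derivable1_diffP;
    exact: integrand_derivable.
- by rewrite derive1E; apply: DeriveDef.
Qed.

Lemma primitive_continuous (s : R) : 0 <= s ->
  {within `[0, s], continuous (primitive phi x)}.
Proof.
move=> s0; apply: parameterized_integral_continuous => //.
apply: continuous_compact_integrable; first exact: segment_compact.
exact: integrand_continuous.
Qed.

Lemma primitive_nondecreasing (s t : R) : 0 <= s -> s <= t ->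
  primitive phi x s <= primitive phi x t.
Proof.
move=> s0 st; have t0 := le_trans s0 st.
have [_ _ phi0 _ _] := hphi.
apply: (@ger0_derive1_le_cc R (primitive phi x) 0 t) => //.
- by move=> u; rewrite in_itv/= => /andP[u0 _];
    have [] := integrand_is_derive_primitive u0.
- move=> u; rewrite in_itv/= => /andP[u0 _]; rewrite derive1E.
  by have [_ ->] := integrand_is_derive_primitive u0; rewrite ltW// phi0.
- exact: primitive_continuous.
- by rewrite in_itv/= s0.
- by rewrite in_itv/= lexx t0.
Qed.

Lemma primitive_ge0 (s : R) : 0 <= s -> 0 <= primitive phi x s.
Proof. by move=> /(primitive_nondecreasing (lexx 0)); rewrite primitive0. Qed.

Lemma mul_primitive_le (s : R) : 0 <= s ->
  pm * primitive phi x s <= s * phi x s.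
Proof.
have [_ _ phi0 _ phile] := hphi => s0.
apply: primitive_mul_le => //.
- exact: primitive0.
- exact: primitive_continuous.
- exact: integrand_continuous.
- exact: integrand_is_derive_primitive.
- exact: integrand_derivable.
by move=> t t0; rewrite -ler_pdivlMr ?phi0//; have /andP[] := phile _ _ Ox t0.
Qed.

Lemma le_mul_primitive (s : R) : 0 <= s ->
  s * phi x s <= pp * primitive phi x s.
Proof.
have [_ _ phi0 _ phile] := hphi => s0.
rewrite -lerN2 -!mulrN.
apply: (@primitive_mul_le R (fun s => - primitive phi x s)
  (fun s => - phi x s)) => //.
- by rewrite primitive0 oppr0.
- by move=> t; apply: cvgN; exact: primitive_continuous.
- by move=> t; apply: cvgN; exact: integrand_continuous.
- move=> t t0; have ? := integrand_is_derive_primitive t0.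
  exact: is_deriveN.
- by move=> t t0; apply: derivableN; exact: integrand_derivable.
move=> t t0; rewrite derive1N; last exact: integrand_derivable.
by rewrite !mulrN lerN2 -ler_pdivrMr ?phi0//; have /andP[] := phile _ _ Ox t0.
Qed.

Lemma powR_le_primitive (s : R) : 1 <= s ->
  primitive phi x 1 * s `^ pm <= primitive phi x s.
Proof.
move=> s1; apply: power_lower_growth s1 integrand_is_derive_primitive _.
by move=> t /ltW; exact: mul_primitive_le.
Qed.

Lemma primitive_le_powR (s : R) : 1 <= s ->
  primitive phi x s <= primitive phi x 1 * s `^ pp.
Proof.
move=> s1; rewrite -lerN2 -mulNr.
apply: (@power_lower_growth R (fun s => - primitive phi x s)
  (fun s => - phi x s)) => //.
- move=> t t0; have ? := integrand_is_derive_primitive t0.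
  exact: is_deriveN.
- by move=> t /ltW t0; rewrite !mulrN lerN2 le_mul_primitive.
Qed.

End Integrand.

(** * The zero function has zero boundary values *)

Section ZeroBoundary.
Context {R : realType} {d : nat}.
Implicit Types (Omega : set 'rV[R]_d) (Phi : 'rV[R]_d -> R -> R).

Lemma iter_derive_cst0 (V : normedModType R) (vs : seq V) :
  iter_derive (cst 0 : V -> R) vs = cst 0.
Proof.
elim: vs => //= v vs ->; apply/funext => x.
exact: derive_cst.
Qed.

Lemma test_function0 (V : normedModType R) (Omega : set V) :
  test_function Omega (cst 0 : V -> R).
Proof.
have supp0 : [set x : V | (cst 0 : V -> R) x != 0] = set0.
  by apply/seteqP; split => // x /=; rewrite eqxx.
rewrite /test_function supp0 closure0; split => //; last exact: compact0.
move=> vs x _; rewrite iter_derive_cst0; split; first exact: cvg_cst.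
by move=> v; exact: derivable_cst.
Qed.

Lemma grad0 : grad (cst 0 : 'rV[R]_d -> R) = cst 0.
Proof.
apply/funext => x; apply/rowP => k; rewrite !mxE.
exact: derive_cst.
Qed.

Lemma loc_integrable0 Omega : loc_integrable Omega (cst 0).
Proof.
split; first exact: measurable_cst.
move=> K _ _; exact: integrable0.
Qed.

Lemma modular0 Omega Phi : (forall x, Phi x 0 = 0) ->
  modular Omega Phi (cst 0) = 0%E.
Proof.
move=> Phi0; rewrite /modular; apply: integral0_eq => x _.
by rewrite /= normr0 Phi0.
Qed.

Lemma LPhi0 Omega Phi : (forall x, Phi x 0 = 0) -> LPhi Omega Phi (cst 0).
Proof.
move=> Phi0; split; first exact: integrable0.
apply: cvg_near_cst; near=> l.
have -> : (fun x => l * cst 0 x) = cst 0 :> ('rV[R]_d -> R).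
  by apply/funext => x /=; rewrite mulr0.
exact: modular0.
Unshelve. all: by end_near. Qed.

(** Makes the boundary datum G itself an admissible competitor, since
    G - G = 0 lies in the closure of the test functions. *)
Lemma W1Phi0_cst0 Omega Phi : (forall x, Phi x 0 = 0) ->
  W1Phi0 Omega Phi (cst 0).
Proof.
move=> Phi0.
have cst0E (k : 'I_d) :
    (fun x => (cst 0 : 'rV[R]_d -> 'rV[R]_d) x ord0 k) = cst 0.
  by apply/funext => x /=; rewrite mxE.
exists (cst 0).
  split; first exact: LPhi0.
    move=> k; rewrite cst0E; split; [exact: loc_integrable0..|].
    move=> psi _; rewrite [X in X = _](_ : _ = 0)
      ?[X in - X](_ : _ = 0) ?oppr0//.
      by rewrite /Rintegral integral0_eq// => x _; rewrite mul0r.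
    by rewrite /Rintegral integral0_eq// => x _; rewrite mul0r.
  by move=> k; rewrite cst0E; exact: LPhi0.
move=> e e0; exists (cst 0); first exact: test_function0.
rewrite grad0; apply: le_lt_trans (_ : (e / 2)%:E < _)%E; last first.
  by rewrite lte_fin; lra.
apply: ereal_inf_lbound; exists (e / 2) => //=; split; first lra.
have modular0' u : (forall x, u x = 0) -> modular Omega Phi u = 0%E.
  by move=> u0; rewrite -(modular0 Omega Phi0); congr modular; exact/funext.
rewrite modular0' => [|x]; last by rewrite /= subrr mul0r.
rewrite add0e big1 ?lee_fin// => k _; rewrite modular0'// => x.
by rewrite subrr mxE mul0r.
Qed.

End ZeroBoundary.

(** * Energy against powers of the gradient *)

Section Energy.
Context {R : realType} {d : nat} (Omega : set 'rV[R]_d).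
Context (phi : 'rV[R]_d -> R -> R) (pm pp : R).
Context (oOmega : open Omega) (hphi : integrand phi pm pp Omega).
Context (hPhi1 : {ae lebesgue_rV R d, forall x, Omega x ->
  primitive phi x 1 = 1}).
Implicit Types (w : 'rV[R]_d -> 'rV[R]_d).
Local Notation lambda := (lebesgue_rV R d).

Lemma enorm_ge0 (v : 'rV[R]_d) : 0 <= enorm v.
Proof. exact: sqrtr_ge0. Qed.

Lemma measurable_enorm w :
  (forall k, measurable_fun Omega (fun x => w x ord0 k)) ->
  measurable_fun Omega (fun x => enorm (w x)).
Proof.
move=> mw; apply: (measurableT_comp
  (continuous_measurable_fun (@sqrt_continuous R))).
apply: measurable_sum => k; exact: measurable_funX.
Qed.

Lemma integrand1_bounds x : Omega x -> primitive phi x 1 = 1 ->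
  [/\ 0 < pm, 0 < phi x 1, pm <= phi x 1 & phi x 1 <= pp].
Proof.
have [_ _ phi0 [pm0 _ _] _] := hphi => Ox P1; split => //; first exact: phi0.
- by have := mul_primitive_le hphi Ox ler01; rewrite P1 mulr1 mul1r.
- by have := le_mul_primitive hphi Ox ler01; rewrite P1 mulr1 mul1r.
Qed.

Lemma energy_density_ge0 x s : Omega x -> 0 <= s ->
  0 <= primitive phi x s / phi x 1.
Proof.
have [_ _ phi0 _ _] := hphi => Ox s0.
by rewrite divr_ge0 ?(primitive_ge0 hphi)// ltW// phi0.
Qed.

Lemma energy_le w M : 1 <= M ->
  {ae lambda, forall x, Omega x -> enorm (w x) <= M} ->
  (energy Omega phi w <= (M `^ pp / pm)%:E * lambda Omega)%E.
Proof.
move=> M1 wM; rewrite -(integral_cst lambda (open_measurable_rV oOmega)).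
have [_ _ _ [pm0 _ _] _] := hphi.
apply: nonmeas_ae_ge0_le_integral.
- by move=> x Ox; rewrite lee_fin energy_density_ge0// enorm_ge0.
- by move=> x _; rewrite /= lee_fin divr_ge0 ?powR_ge0// ltW.
apply: filterS2 wM hPhi1 => x wM P1 Ox.
have [_ phi10 pmphi _] := integrand1_bounds Ox (P1 Ox).
rewrite /= lee_fin ler_pM ?invr_ge0 ?(ltW phi10) ?(primitive_ge0 hphi)
  ?enorm_ge0//.
- apply: le_trans (_ : primitive phi x M <= _).
    by rewrite (primitive_nondecreasing hphi)// ?enorm_ge0// wM.
  by have := primitive_le_powR hphi Ox M1; rewrite (P1 Ox) mul1r.
- by rewrite lef_pV2 ?posrE.
Qed.

(** Below K the first term suffices.  Above it,
    (s / K) ^ m <= (s / K) ^ pm because s / K >= 1 and m <= pm, and s ^ pm is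
    controlled by the primitive, whose denominator phi x 1 is at most pp. *)
Lemma powR_le_energy_density x s K m : Omega x -> primitive phi x 1 = 1 ->
  0 <= s -> 1 <= K -> 0 <= m -> m <= pm ->
  s `^ m <= K `^ m + pp * K `^ (m - pm) * (primitive phi x s / phi x 1).
Proof.
move=> Ox P1 s0 K1 m0 mpm.
have [pm0 phi10 pmphi phipp] := integrand1_bounds Ox P1.
have pp0 : 0 < pp by exact: lt_le_trans phi10 phipp.
have K0 : 0 < K by exact: lt_le_trans K1.
have [sK|/ltW Ks] := leP s K.
  rewrite (le_trans (ge0_ler_powR m0 _ _ sK)) ?nnegrE// ?(ltW K0)//.
  by rewrite lerDl mulr_ge0 ?energy_density_ge0// mulr_ge0 ?powR_ge0// ltW.
have s1 : 1 <= s by exact: le_trans Ks.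
rewrite -[leLHS]add0r lerD ?powR_ge0//.
have sE : s = K * (s / K) by rewrite mulrC divfK// gt_eqF.
apply: le_trans (_ : K `^ (m - pm) * s `^ pm <= _).
  have K_neq0 : K != 0 by rewrite gt_eqF.
  have sK0 : 0 <= s / K by rewrite divr_ge0// ltW.
  rewrite {1 2}sE !(powRM _ (ltW K0) sK0).
  rewrite [leRHS]mulrA -powRD ?K_neq0 ?implybT// subrK ler_wpM2l ?powR_ge0//.
  by rewrite ler_powR// ler_pdivlMr// mul1r.
rewrite mulrAC [leRHS]mulrC ler_wpM2l ?powR_ge0//.
apply: le_trans (_ : primitive phi x s <= _).
  by have := powR_le_primitive hphi Ox s1; rewrite P1 mul1r.
rewrite mulrCA ler_peMr ?(primitive_ge0 hphi)//.
by rewrite ler_pdivlMr// mul1r.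
Qed.

Lemma integral_powR_le_energy w K m :
  (forall k, measurable_fun Omega (fun x => w x ord0 k)) ->
  1 <= K -> 0 <= m -> m <= pm ->
  (\int[lambda]_(x in Omega) (enorm (w x) `^ m)%:E <=
   (K `^ m)%:E * lambda Omega +
   (pp * K `^ (m - pm))%:E * energy Omega phi w)%E.
Proof.
move=> mw K1 m0 mpm.
set C := pp * K `^ (m - pm).
have mOmega := open_measurable_rV oOmega.
have C0 : 0 < C.
  have [_ _ _ [_ pp0' _] _] := hphi.
  by rewrite mulr_gt0// powR_gt0// (lt_le_trans ltr01).
(* the measurable part of |w| ^ m that the energy density has to dominate *)
pose h x := Num.max 0 (enorm (w x) `^ m - K `^ m) / C.
have h0 x : 0 <= h x by rewrite divr_ge0 ?(ltW C0)// le_max lexx.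
have mwm : measurable_fun Omega (fun x => enorm (w x) `^ m).
  exact: (measurableT_comp (@measurable_powR R m) (measurable_enorm mw)).
have mh : measurable_fun Omega h.
  apply: measurable_funM => //; apply: measurable_maxr => //.
  exact: measurable_funB.
apply: le_trans (_ : (\int[lambda]_(x in Omega)
    ((K `^ m)%:E + C%:E * (h x)%:E) <= _)%E).
  apply: ge0_le_integral => //.
  - by move=> x _; rewrite lee_fin powR_ge0.
  - exact/measurable_EFinP.
  - apply/measurable_EFinP; apply: measurable_funD => //.
    exact: measurable_funM.
  move=> x _; rewrite lee_fin /h mulrC divfK ?gt_eqF// -lerBlDl.
  by rewrite le_max lexx orbT.
rewrite ge0_integralD//; last 3 first.
- by move=> x _; rewrite lee_fin powR_ge0.
- by move=> x _; rewrite lee_fin mulr_ge0// ltW.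
- apply/measurable_EFinP; exact: measurable_funM.
rewrite (integral_cst lambda mOmega) leeD2l//.
rewrite ge0_integralZl_EFin//; last 3 first.
- by move=> x _; rewrite lee_fin.
- exact/measurable_EFinP.
- exact: ltW.
rewrite lee_pmul2l//; apply: nonmeas_ae_ge0_le_integral.
- by move=> x _; rewrite lee_fin.
- by move=> x Ox; rewrite lee_fin energy_density_ge0// enorm_ge0.
apply: filterS hPhi1 => x P1 Ox.
rewrite lee_fin ler_pdivrMr// ge_max mulr_ge0 ?energy_density_ge0
  ?enorm_ge0 ?(ltW C0)//=.
rewrite lerBlDl [X in _ + X]mulrC.
exact: powR_le_energy_density (P1 Ox) (enorm_ge0 _) K1 m0 mpm.
Qed.

End Energy.

(** * Norms over a subset *)

Section LnormOn.
Context {R : realType} {d : nat}.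
Implicit Types (Omega : set 'rV[R]_d) (f : 'rV[R]_d -> R).
Local Notation lambda := (lebesgue_rV R d).

(** The norm with exponent +oo is 0 by convention on a space of measure 0; there
    the conclusion holds because everything is negligible. *)
Lemma ae_le_Lnorm_on_oo Omega f (c : R) : (Lnorm_on Omega +oo f <= c%:E)%E ->
  {ae lambda, forall x, Omega x -> `|f x| <= c}.
Proof.
rewrite /Lnorm_on unlock /Lnorm; case: ifPn => [_ /ess_supP|].
  apply: filterS => x /= + Ox.
  by rewrite /patch mem_set// lee_fin.
rewrite -leNgt => lambda0 _; exists setT; split => //.
by apply/eqP; rewrite eq_le lambda0 measure_ge0.
Qed.

Lemma Lnorm_on_EFin Omega f (m : R) : 0 < m ->
  Lnorm_on Omega m%:E f =
  ((\int[lambda]_(x in Omega) (`|f x| `^ m)%:E) `^ m^-1)%E.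
Proof.
move=> m0; rewrite /Lnorm_on unlock /Lnorm [in RHS]integral_mkcond.
congr (_ `^ _)%E; apply: eq_integral => x _.
rewrite /= /patch; case: ifPn => // _.
by rewrite normr0 powR0// gt_eqF.
Qed.

End LnormOn.

(** * Two elementary inequalities *)

Section Numeric.
Context {R : realType}.
Implicit Types (a m mu eta V : R).

Lemma powR_inv_le a m : 0 <= a -> 1 <= m -> a `^ m^-1 <= 1 + a.
Proof.
move=> a0 m1; have m0 : 0 < m by exact: lt_le_trans m1.
apply: le_trans (_ : (1 + a) `^ m^-1 <= _).
  by rewrite ge0_ler_powR ?nnegrE ?invr_ge0 ?(ltW m0) ?addr_ge0// lerDr.
by rewrite ler1_powR ?lerDl// invf_le1.
Qed.

Lemma max1_powR_le mu eta : Num.max 1 eta `^ mu <= 1 + eta `^ mu.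
Proof.
have [_|_] := leP eta 1; first by rewrite powR1 lerDl powR_ge0.
by rewrite lerDr.
Qed.

End Numeric.

(** * The gradient bound *)

Theorem theorem9 (R : realType) (d : nat) (Omega : set 'rV[R]_d)
    (phi : nat -> 'rV[R]_d -> R -> R) (pm pp : nat -> R) (mu : R)
    (g G : 'rV[R]_d -> R) (dG : 'rV[R]_d -> 'rV[R]_d) (eta : R)
    (u : nat -> 'rV[R]_d -> R)
    (hd : (0 < d)%N)
    (hOmega : smooth_domain Omega) (hbounded : bounded_set Omega)
    (hphi : forall n, (1 <= n)%N -> integrand (phi n) (pm n) (pp n) Omega)
    (hlim : pm n @[n --> \oo] --> +oo)
    (hmu : 1 < mu) (hpp : forall n, (1 <= n)%N -> pp n <= mu * pm n)
    (hPhi1 : forall n, (1 <= n)%N ->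
      {ae lebesgue_rV R d, forall x, Omega x -> primitive (phi n) x 1 = 1})
    (heta : lip_const (boundary Omega) g = eta%:E)
    (hG : is_amle Omega g G)
    (hdG : is_weak_grad Omega G dG)
    (hdG_eta : (Lnorm_on Omega +oo (fun x => enorm (dG x)) <= eta%:E)%E)
    (hu : forall n, (1 <= n)%N ->
      is_unique_minimizer Omega (phi n) G (u n)) :
  forall (m : R) (n : nat) (du : 'rV[R]_d -> 'rV[R]_d),
    1 <= m -> (1 <= n)%N -> m <= pm n -> is_weak_grad Omega (u n) du ->
    (Lnorm_on Omega m%:E (fun x => enorm (du x)) <=
      (12 * mu * (1 + eta `^ mu))%:E * (1 + lebesgue_rV R d Omega) ^+ 2)%E.
Proof.
move=> m n du m1 n1 mpm hdu.
have oOmega : open Omega by case: hOmega.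
have mOmega := open_measurable_rV oOmega.
have hn := hphi n n1; have [_ _ _ [pm0 pp0 _] _] := hn.
have m0 : 0 < m by exact: lt_le_trans m1.
have mu0 : 0 < mu by exact: lt_trans hmu.
have rhs0 : 0 < 12 * mu * (1 + eta `^ mu).
  by rewrite !mulr_gt0// ltr_wpDr// powR_ge0.
(* on a domain of infinite measure the right-hand side is +oo *)
have [Voo|] := eqVneq (lebesgue_rV R d Omega) +oo%E.
  by rewrite Voo addey// expe2 mulyy mulry gtr0_sg// mul1e leey.
rewrite -ltey -ge0_fin_numE ?measure_ge0// => /fineK VE.
set V := fine _ in VE.
have V0 : 0 <= V by rewrite fine_ge0.
set M := Num.max 1 eta; set K := M `^ mu.
have M1 : 1 <= M by rewrite le_max lexx.
have K1 : 1 <= K by rewrite (le_trans M1)// le1r_powR// ltW.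
have K0 : 0 < K by exact: lt_le_trans K1.
have dGM : {ae lebesgue_rV R d, forall x, Omega x -> enorm (dG x) <= M}.
  apply: filterS (ae_le_Lnorm_on_oo hdG_eta) => x + Ox => /(_ Ox).
  rewrite ger0_norm ?enorm_ge0// => /le_trans; apply.
  by rewrite le_max lexx orbT.
have Edu : (energy Omega (phi n) du <= (K `^ pm n / pm n * V)%:E)%E.
  apply: le_trans (_ : energy Omega (phi n) dG <= _)%E.
    have [[_ minu] _] := hu n n1; apply: minu => //.
    have -> : G \- G = cst 0 by apply/funext => x /=; rewrite subrr.
    by apply: W1Phi0_cst0 => x; exact: primitive0.
  apply: le_trans (energy_le oOmega hn (hPhi1 n n1) M1 dGM) _.
  rewrite -VE -EFinM lee_fin ler_wpM2r// ler_pM2r ?invr_gt0//.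
  by rewrite /K -powRrM ler_powR// hpp.
have mdu k : measurable_fun Omega (fun x => du x ord0 k).
  by have [_ [] ] := hdu k.
have Idu : (\int[lebesgue_rV R d]_(x in Omega) (enorm (du x) `^ m)%:E <=
    (K `^ m * ((1 + mu) * V))%:E)%E.
  apply: le_trans (integral_powR_le_energy oOmega hn (hPhi1 n n1) mdu K1
    (ltW m0) mpm) _.
  rewrite -VE; apply: le_trans (_ : (K `^ m)%:E * V%:E +
    (pp n * K `^ (m - pm n))%:E * (K `^ pm n / pm n * V)%:E <= _)%E.
    by rewrite leeD2l// lee_wpmul2l// lee_fin mulr_ge0 ?powR_ge0// ltW.
  rewrite -!EFinM -EFinD lee_fin.
  have KE : K `^ m = K `^ (m - pm n) * K `^ pm n.
    by rewrite -powRD ?subrK// gt_eqF// implybT.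
  have -> : pp n * K `^ (m - pm n) * (K `^ pm n / pm n * V) =
      pp n / pm n * (K `^ m * V) by rewrite KE; ring.
  have : pp n / pm n <= mu by rewrite ler_pdivrMr// hpp.
  have : 0 <= K `^ m * V by rewrite mulr_ge0// powR_ge0.
  nra.
rewrite Lnorm_on_EFin//.
under eq_integral do rewrite ger0_norm ?enorm_ge0//.
apply: le_trans (_ : (K * (1 + (1 + mu) * V))%:E <= _)%E.
  have W0 : 0 <= (1 + mu) * V by rewrite mulr_ge0// addr_ge0// ltW.
  apply: le_trans (_ : ((K `^ m * ((1 + mu) * V))%:E `^ m^-1 <= _)%E).
    apply: gt0_ler_poweR Idu; rewrite ?invr_ge0 ?(ltW m0)//.
      rewrite in_itv/= leey andbT integral_ge0// => x _.
      by rewrite lee_fin powR_ge0.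
    by rewrite in_itv/= leey andbT lee_fin mulr_ge0// powR_ge0.
  rewrite poweR_EFin lee_fin powRM ?powR_ge0//.
  rewrite -powRrM divff ?gt_eqF// powRr1 ?(ltW K0)//.
  by rewrite ler_pM2l// powR_inv_le.
rewrite -VE -EFinD -EFin_expe -EFinM lee_fin.
rewrite [leRHS](_ : _ = (1 + eta `^ mu) * (12 * mu * (1 + V) ^+ 2));
  last by ring.
apply: ler_pM; rewrite ?(ltW K0)//.
- by rewrite addr_ge0// mulr_ge0// addr_ge0// ltW.
- exact: max1_powR_le.
- by nra.
Qed.
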